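(* The inequality $\frac{\sin x}{x}>M(\cos x;q)$ holds for all $x\in(0,\pi/2)$ if and only if $q\le\frac{34}{35}$, while the reverse inequality $\frac{\sin x}{x}<M(\cos x;q)$ holds for all $x\in(0,\pi/2)$ if and only if $q\ge q_0\approx0.989681$, where $q_0$ is the unique positive root of $\delta(q)=0$.
   Context: For $t\in(0,1)$ and $q\in\mathbb{R}$: $M(t;q)=\left(\frac{8}{15q}+\left(1-\frac{8}{15q}\right)t^q\right)^{5/(15q-8)}$ if $q\ne0,\frac8{15}$; $M(t;0)=\left(1-\frac8{15}\ln t\right)^{-5/8}$; $M(t;\frac8{15})=\exp\frac{5(t^{8/15}-1)}{8}$. For $q>0$ define $\delta(q)=\frac{1-(2/\pi)^{3q-8/5}}{3q-8/5}-\frac1{3q}$ if $q\ne\frac8{15}$ and $\delta(\frac8{15})=\ln\frac\pi2-\frac58$. *)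

(* Defs.v *)
From Stdlib Require Import Reals.
Open Scope R_scope.

(* M(t;q), intended for t in (0,1); arguments in the paper's order M(t;q).
   Real powers use Rpower (x^y = exp (y ln x)); all bases are > 0 for t in (0,1). *)
Definition M (t q : R) : R :=
  if Req_EM_T q 0 then Rpower (1 - 8/15 * ln t) (-(5/8))
  else if Req_EM_T q (8/15) then exp (5 * (Rpower t (8/15) - 1) / 8)
  else Rpower (8 / (15 * q) + (1 - 8 / (15 * q)) * Rpower t q) (5 / (15 * q - 8)).

(* delta(q), intended for q > 0. *)
Definition delta (q : R) : R :=
  if Req_EM_T q (8/15) then ln (PI / 2) - 5/8
  else (1 - Rpower (2 / PI) (3 * q - 8/5)) / (3 * q - 8/5) - 1 / (3 * q).

(* Main.v *)
Require Import Defs.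
From Stdlib Require Import Reals Lra Lia Classical Ranalysis5.
From Coquelicot Require Import Coquelicot.
Open Scope R_scope.

(* Put U_p(s) = (1 - s^p)/p, with U_0(s) = - ln s. Then m = M(t;q) is the solution of
   U_(3q-8/5)(m) = U_q(t)/3, so comparing sin x / x with M(cos x; q) amounts to finding the sign of
   gap(x) = U_(3q-8/5)(sin x / x) - U_q(cos x)/3, which tends to 0 at 0 and to delta(q) at PI/2.
   The derivative of gap has the sign of a function slope(x), the logarithm of the quotient of its
   two terms, which also tends to 0 at 0, and slope'(x) has the sign of rho(2x) - (1 - q), where
   rho does not depend on q and decreases on (0, PI) from 1/35 to values that remain positive.
   Hence slope', slope, gap' and gap are all negative if q <= 34/35 and all positive if q >= 1.
   For every q, once slope' is nonpositive it stays negative, and this property is inherited by a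
   primitive vanishing at 0, so by slope, gap' and gap; therefore gap > 0 on (0, PI/2) as soon as
   delta(q) >= 0. Finally delta increases on [34/35, 1], from a negative to a positive value. *)

(** * Taylor bounds for sine and cosine *)

(* [INR (fact n)] computed in [R], so that [fact 12] is never evaluated as a unary number. *)
Fixpoint rfact (n : nat) : R :=
  match n with O => 1 | S m => INR (S m) * rfact m end.

(** [n] counts terms, so the degrees are 2n - 2 here and 2n - 1 in [sin_taylor]. Hence
    [sin_taylor n] has derivative [cos_taylor n], but it is [cos_taylor (S n)] whose derivative is
    [- sin_taylor n]. *)
Fixpoint cos_taylor (n : nat) (x : R) : R :=
  match n with
  | O => 0
  | S m => cos_taylor m x + (-1) ^ m * (x ^ (2 * m) / rfact (2 * m))
  end.

Fixpoint sin_taylor (n : nat) (x : R) : R :=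
  match n with
  | O => 0
  | S m => sin_taylor m x + (-1) ^ m * (x ^ (2 * m + 1) / rfact (2 * m + 1))
  end.

Lemma rfact_pos n : 0 < rfact n.
Proof.
  induction n as [|n IH]; [simpl; lra|].
  change (0 < INR (S n) * rfact n).
  apply Rmult_lt_0_compat; [apply lt_0_INR; lia | exact IH].
Qed.

Lemma is_derive_pow_div_fact n (x : R) :
  is_derive (fun y => y ^ S n / rfact (S n)) x (x ^ n / rfact n).
Proof.
  assert (Hn := rfact_pos n).
  assert (Hi : 0 < INR (S n)) by (apply lt_0_INR; lia).
  change (is_derive (fun y => y ^ S n / (INR (S n) * rfact n)) x (x ^ n / rfact n)).
  auto_derive; [exact I|].
  simpl in *; field; split; lra.
Qed.

Lemma is_derive_sin_taylor n (x : R) : is_derive (sin_taylor n) x (cos_taylor n x).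
Proof.
  induction n as [|n IH].
  - apply (is_derive_const 0).
  - apply @is_derive_plus; [exact IH|].
    replace (2 * n + 1)%nat with (S (2 * n)) by lia.
    apply is_derive_scal, is_derive_pow_div_fact.
Qed.

Lemma is_derive_cos_taylor n (x : R) :
  is_derive (cos_taylor (S n)) x (- sin_taylor n x).
Proof.
  induction n as [|n IH].
  - apply is_derive_ext with (fun _ => 1).
    + intros t; simpl; field.
    + simpl; rewrite Ropp_0; apply (is_derive_const 1).
  - change (is_derive
              (fun y => cos_taylor (S n) y + (-1) ^ S n * (y ^ (2 * S n) / rfact (2 * S n))) x
              (- (sin_taylor n x + (-1) ^ n * (x ^ (2 * n + 1) / rfact (2 * n + 1))))).
    rewrite Ropp_plus_distr; apply @is_derive_plus; [exact IH|].
    replace (2 * S n)%nat with (S (2 * n + 1)) by lia.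
    replace (- ((-1) ^ n * (x ^ (2 * n + 1) / rfact (2 * n + 1))))
      with ((-1) ^ S n * (x ^ (2 * n + 1) / rfact (2 * n + 1))) by (simpl; ring).
    apply is_derive_scal, is_derive_pow_div_fact.
Qed.

Lemma derive_nonneg_le (f df : R -> R) (a b : R) :
  a <= b -> (forall x, a <= x <= b -> is_derive f x (df x)) ->
  (forall x, a <= x <= b -> 0 <= df x) -> f a <= f b.
Proof.
  intros Hab Hd Hp.
  destruct (MVT_gen f a b df) as [c [Hc E]].
  - intros x Hx; apply Hd; rewrite Rmin_left, Rmax_right in Hx; lra.
  - intros x Hx; rewrite Rmin_left, Rmax_right in Hx by lra.
    apply continuity_pt_filterlim, (ex_derive_continuous f x).
    exists (df x); apply Hd; lra.
  - rewrite Rmin_left, Rmax_right in Hc by lra.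
    assert (0 <= df c * (b - a)) by (apply Rmult_le_pos; [apply Hp|]; lra).
    lra.
Qed.

Lemma sin_taylor_0 n : sin_taylor n 0 = 0.
Proof.
  induction n as [|n IH]; [reflexivity|].
  change (sin_taylor n 0 + (-1) ^ n * (0 ^ (2 * n + 1) / rfact (2 * n + 1)) = 0).
  rewrite IH, pow_i by lia; unfold Rdiv; ring.
Qed.

Lemma cos_taylor_0 n : cos_taylor (S n) 0 = 1.
Proof.
  induction n as [|n IH]; [simpl; field|].
  change (cos_taylor (S n) 0 + (-1) ^ S n * (0 ^ (2 * S n) / rfact (2 * S n)) = 1).
  rewrite IH, pow_i by lia; unfold Rdiv; ring.
Qed.

(** Each remainder is, up to sign, the primitive vanishing at 0 of the preceding one (cosine, sine,
    cosine with one more term, and so on); the chain starts from cos x <= 1. *)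
Lemma taylor_remainder_sign n x : 0 <= x ->
  0 <= (-1) ^ S n * (cos x - cos_taylor (S n) x) /\
  0 <= (-1) ^ S n * (sin x - sin_taylor (S n) x).
Proof.
  revert x; induction n as [|n IH].
  - assert (Hc : forall x, 0 <= x -> 0 <= (-1) ^ 1 * (cos x - cos_taylor 1 x)).
    { intros x Hx; simpl; destruct (COS_bound x); lra. }
    intros x Hx; split; [now apply Hc|].
    replace 0 with ((-1) ^ 1 * (sin 0 - sin_taylor 1 0))
      by (rewrite sin_0, sin_taylor_0; ring).
    apply (derive_nonneg_le (fun y => (-1) ^ 1 * (sin y - sin_taylor 1 y))
             (fun y => (-1) ^ 1 * (cos y - cos_taylor 1 y))); [lra| |].
    + intros y _; apply is_derive_scal, @is_derive_minus;
        [apply is_derive_sin | apply is_derive_sin_taylor].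
    + intros y Hy; apply Hc; lra.
  - assert (Hc : forall x, 0 <= x ->
                 0 <= (-1) ^ S (S n) * (cos x - cos_taylor (S (S n)) x)).
    { intros x Hx.
      replace 0 with ((-1) ^ S (S n) * (cos 0 - cos_taylor (S (S n)) 0))
        by (rewrite cos_0, cos_taylor_0; ring).
      apply (derive_nonneg_le
               (fun y => (-1) ^ S (S n) * (cos y - cos_taylor (S (S n)) y))
               (fun y => (-1) ^ S (S n) * (- sin y - - sin_taylor (S n) y))); [lra| |].
      - intros y _; apply is_derive_scal, @is_derive_minus;
          [apply is_derive_cos | apply is_derive_cos_taylor].
      - intros y Hy; destruct (IH y) as [_ H]; [lra|].
        replace ((-1) ^ S (S n)) with (- (-1) ^ S n) by (simpl; ring); lra. }
    intros x Hx; split; [now apply Hc|].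
    replace 0 with ((-1) ^ S (S n) * (sin 0 - sin_taylor (S (S n)) 0))
      by (rewrite sin_0, sin_taylor_0; ring).
    apply (derive_nonneg_le (fun y => (-1) ^ S (S n) * (sin y - sin_taylor (S (S n)) y))
             (fun y => (-1) ^ S (S n) * (cos y - cos_taylor (S (S n)) y))); [lra| |].
    + intros y _; apply is_derive_scal, @is_derive_minus;
        [apply is_derive_sin | apply is_derive_sin_taylor].
    + intros y Hy; apply Hc; lra.
Qed.

Lemma cos_taylor_bound n y : 0 <= y -> 0 <= (-1) ^ S n * (cos y - cos_taylor (S n) y).
Proof. intros Hy; apply taylor_remainder_sign; exact Hy. Qed.

Lemma sin_taylor_bound n y : 0 <= y -> 0 <= (-1) ^ S n * (sin y - sin_taylor (S n) y).
Proof. intros Hy; apply taylor_remainder_sign; exact Hy. Qed.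

Lemma cos_ge_quadratic x : 0 <= x -> 1 - x^2 / 2 <= cos x.
Proof.
  intros Hx; assert (H := cos_taylor_bound 1 x Hx).
  cbv [cos_taylor rfact Nat.mul Nat.add] in H; simpl in H; lra.
Qed.

Lemma sin_ge_cubic x : 0 <= x -> x - x^3 / 6 <= sin x.
Proof.
  intros Hx; assert (H := sin_taylor_bound 1 x Hx).
  cbv [sin_taylor rfact Nat.mul Nat.add] in H; simpl in H; lra.
Qed.

(** The remainder bound is multiplied by [y ^ k] and expanded, so that products such as y^2 cos y
    are bounded linearly. The polynomial is a lower bound for odd [n], an upper bound for even
    [n]. *)
Ltac taylor_bound T n y k Hy :=
  let H := fresh "HT" in
  pose proof (Rmult_le_pos _ _ (pow_le y k Hy) (T n y Hy)) as H;
  cbv [cos_taylor sin_taylor rfact Nat.mul Nat.add] in H;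
  repeat rewrite S_INR in H; change (INR 0) with 0 in H;
  simpl pow in H; unfold Rdiv in H.

(* [a * y^m * r] is the difference of the two sides of the goal after [sin] and [cos] have
   been replaced by the Taylor polynomials recorded by [taylor_bound]. *)
Ltac taylor_finish y a m r :=
  let H := fresh "HR" in
  assert (H : 0 < a * y ^ m * r);
  [ apply Rmult_lt_0_compat;
    [ apply Rmult_lt_0_compat; [lra | apply pow_lt; lra]
    | first [ lra | nra | assert (0 < y^2 < 9.93) by nra; nra ] ]
  | simpl pow in *; lra ].

(* With [y = 2x]: [numer] is [20 x sin x (sin x - x cos x)] times the derivative of [slope 1]
   at [x], [denom] is [2 x sin x cos x] times [tan x + 3 cot x - 3/x], which is the derivative of
   [3 ln (sin x / x) - ln (cos x)], and [tmx] is [4 (cos x)^2 (tan x - x)]. *)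
Definition numer (y : R) : R := 4 * y^2 - y^2 * cos y - 24 + 24 * cos y + 9 * y * sin y.
Definition dnumer (y : R) : R := 8 * y + 7 * y * cos y + y^2 * sin y - 15 * sin y.
Definition denom (y : R) : R := 2 * y + y * cos y - 3 * sin y.
Definition ddenom (y : R) : R := 2 - 2 * cos y - y * sin y.
Definition tmx (y : R) : R := 2 * sin y - y - y * cos y.

(** Near 0, [numer], [denom] and [tmx] behave like y^8/5040, y^5/60 and y^3/6, whence the 8, 5 and 3
    here and in the next two lemmas. As 8 = 5 + 3, these parts balance, and so do the corrections
    y^2/8; near 0 any common coefficient between 2/21 and 1/5 would do. *)
Lemma numer_log_derive y : 0 < y < 3.15 -> y * dnumer y < 8 * numer y.
Proof.
  intros [H0 H1]; unfold numer, dnumer.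
  assert (Hy : 0 <= y) by lra.
  taylor_bound cos_taylor_bound 6%nat y 2%nat Hy.
  taylor_bound cos_taylor_bound 5%nat y 0%nat Hy.
  taylor_bound sin_taylor_bound 5%nat y 1%nat Hy.
  taylor_bound sin_taylor_bound 4%nat y 3%nat Hy.
  taylor_finish y (1/75600) 10%nat (1 - 2/33*y^2 - 5/2112*y^4).
Qed.

Lemma denom_log_derive y : 0 < y < 3.15 -> (5 - y^2 / 8) * denom y < y * ddenom y.
Proof.
  intros [H0 H1]; unfold denom, ddenom.
  assert (Hy : 0 <= y) by lra.
  taylor_bound cos_taylor_bound 4%nat y 1%nat Hy.
  taylor_bound sin_taylor_bound 4%nat y 2%nat Hy.
  taylor_bound cos_taylor_bound 5%nat y 3%nat Hy.
  taylor_bound sin_taylor_bound 5%nat y 0%nat Hy.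
  taylor_finish y (1/252/8) 7%nat (1 - 1/15*y^2 - 17/7920*y^4 - 1/14400*y^6).
Qed.

(** [(1 - cos y) / tmx y] is the logarithmic derivative of [tmx y / (1 + cos y)], which is 2 (tan x
    - x) for y = 2x. *)
Lemma tmx_log_derive y : 0 < y < 3.15 -> (3 + y^2 / 8) * tmx y < y * (1 - cos y).
Proof.
  intros [H0 H1]; unfold tmx.
  assert (Hy : 0 <= y) by lra.
  taylor_bound cos_taylor_bound 3%nat y 1%nat Hy.
  taylor_bound sin_taylor_bound 2%nat y 0%nat Hy.
  taylor_bound sin_taylor_bound 4%nat y 2%nat Hy.
  taylor_bound cos_taylor_bound 3%nat y 3%nat Hy.
  taylor_finish y (1/10/8) 5%nat (1 + 1/36*y^2 - 5/504*y^4 - 1/18144*y^6).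
Qed.

(** Here and in the next four lemmas the bound is the start of the Taylor expansion at 0: one term
    from above, two from below. *)
Lemma numer_upper y : 0 < y < 3.15 -> numer y < y^8 / 5040.
Proof.
  intros [H0 H1]; unfold numer.
  assert (Hy : 0 <= y) by lra.
  taylor_bound cos_taylor_bound 5%nat y 2%nat Hy.
  taylor_bound cos_taylor_bound 6%nat y 0%nat Hy.
  taylor_bound sin_taylor_bound 4%nat y 1%nat Hy.
  taylor_finish y (1/151200) 10%nat (1 - 13/264*y^2).
Qed.

Lemma numer_lower y : 0 < y < 3.15 -> y^8 / 5040 * (1 - y^2 / 30) < numer y.
Proof.
  intros [H0 H1]; unfold numer.
  assert (Hy : 0 <= y) by lra.
  taylor_bound cos_taylor_bound 6%nat y 2%nat Hy.
  taylor_bound cos_taylor_bound 5%nat y 0%nat Hy.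
  taylor_bound sin_taylor_bound 5%nat y 1%nat Hy.
  taylor_finish y (1/19958400) 12%nat (1 - 1/24*y^2).
Qed.

Lemma denom_lower y : 0 < y < 3.15 -> y^5 / 60 * (1 - y^2 / 21) < denom y.
Proof.
  intros [H0 H1]; unfold denom.
  assert (Hy : 0 <= y) by lra.
  taylor_bound cos_taylor_bound 5%nat y 1%nat Hy.
  taylor_bound sin_taylor_bound 4%nat y 0%nat Hy.
  taylor_finish y (1/60480) 9%nat (1 - 1/60*y^2).
Qed.

Lemma denom_upper y : 0 < y < 3.15 -> denom y < y^5 / 60.
Proof.
  intros [H0 H1]; unfold denom.
  assert (Hy : 0 <= y) by lra.
  taylor_bound cos_taylor_bound 4%nat y 1%nat Hy.
  taylor_bound sin_taylor_bound 3%nat y 0%nat Hy.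
  taylor_finish y (1/1260) 7%nat (1 - 1/32*y^2).
Qed.

Lemma tmx_upper y : 0 < y < 3.15 -> tmx y < y^3 / 6.
Proof.
  intros [H0 H1]; unfold tmx.
  assert (Hy : 0 <= y) by lra.
  taylor_bound cos_taylor_bound 3%nat y 1%nat Hy.
  taylor_bound sin_taylor_bound 2%nat y 0%nat Hy.
  taylor_finish y (1/40) 5%nat (1 - 1/18*y^2).
Qed.

(** So the range (0, 3.15) of the bounds above contains (0, PI). If 1.575 <= PI/2, then cos 1.575 >=
    0, against the Taylor polynomial of degree 8. *)
Lemma PI_upper : PI < 3.15.
Proof.
  destruct (Rlt_or_le PI 3.15) as [H|H]; [exact H|exfalso].
  assert (Hy : 0 <= 1.575) by lra.
  assert (0 <= cos 1.575) by (apply cos_ge_0; lra).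
  taylor_bound cos_taylor_bound 4%nat 1.575 0%nat Hy.
  lra.
Qed.

(** The first two terms of the series of tan x - x, cleared of the denominator [cos x]. *)
Lemma sin_sub_mul_cos_lower x : 0 < x < 1.575 ->
  (x^3 / 3 + 2 * x^5 / 15) * cos x < sin x - x * cos x.
Proof.
  intros [H0 H1].
  assert (Hy : 0 <= x) by lra.
  taylor_bound sin_taylor_bound 3%nat x 0%nat Hy.
  taylor_bound cos_taylor_bound 2%nat x 1%nat Hy.
  taylor_bound cos_taylor_bound 2%nat x 3%nat Hy.
  taylor_bound cos_taylor_bound 2%nat x 5%nat Hy.
  taylor_finish x (53/1008) 7%nat (1 - 28/265*x^2).
Qed.

Lemma sin_sub_mul_cos_upper x : 0 < x -> sin x - x * cos x < x^3 / 3 + x^5 / 60.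
Proof.
  intros H0.
  assert (Hy : 0 <= x) by lra.
  taylor_bound sin_taylor_bound 2%nat x 0%nat Hy.
  taylor_bound cos_taylor_bound 1%nat x 1%nat Hy.
  taylor_finish x (1/120) 5%nat 1.
Qed.

(** * The function rho *)

(** [rho (2 * x)] is the derivative of [slope 1] divided by that of 3 ln (sin x / x) - ln (cos x),
    the function whose multiple by 1 - q is subtracted from [slope 1] to give [slope q]. *)
Definition rho (y : R) : R := numer y * (1 + cos y) / (5 * denom y * tmx y).

Lemma numer_pos y : 0 < y < 3.15 -> 0 < numer y.
Proof.
  intros Hy; assert (H := numer_lower y Hy).
  assert (0 < y^8 / 5040 * (1 - y^2 / 30)); [|lra].
  apply Rmult_lt_0_compat; [apply Rdiv_lt_0_compat; [apply pow_lt|]; lra | nra].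
Qed.

Lemma denom_pos y : 0 < y < 3.15 -> 0 < denom y.
Proof.
  intros Hy; assert (H := denom_lower y Hy).
  assert (0 < y^5 / 60 * (1 - y^2 / 21)); [|lra].
  apply Rmult_lt_0_compat; [apply Rdiv_lt_0_compat; [apply pow_lt|]; lra | nra].
Qed.

Lemma tmx_double x : tmx (2 * x) = 4 * cos x * (sin x - x * cos x).
Proof. unfold tmx; rewrite sin_2a, cos_2a_cos; ring. Qed.

Lemma tan_sub_pos x : 0 < x < PI / 2 -> 0 < sin x - x * cos x.
Proof.
  intros Hx; assert (HP := PI_upper).
  assert (0 < cos x) by (apply cos_gt_0; lra).
  assert (H1 := sin_sub_mul_cos_lower x ltac:(lra)).
  assert (0 < (x^3 / 3 + 2 * x^5 / 15) * cos x); [|lra].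
  apply Rmult_lt_0_compat; [|assumption].
  assert (0 < x^3) by (apply pow_lt; lra).
  assert (0 < x^5) by (apply pow_lt; lra). lra.
Qed.

Lemma one_plus_cos_pos y : 0 < y < PI -> 0 < 1 + cos y.
Proof.
  intros Hy.
  replace y with (2 * (y / 2)) by field; rewrite cos_2a_cos.
  assert (0 < cos (y / 2)) by (apply cos_gt_0; lra). nra.
Qed.

(** The factor [1 + cos y], which vanishes at PI, cancels against the numerator of [rho]; this makes
    the bound usable up to PI. *)
Lemma tmx_lower y : 0 < y < PI -> (1 + cos y) * (y^3 / 12 * (1 + y^2 / 10)) < tmx y.
Proof.
  intros Hy; assert (HP := PI_upper).
  assert (0 < cos (y / 2)) by (apply cos_gt_0; lra).
  assert (H1 := sin_sub_mul_cos_lower (y / 2) ltac:(lra)).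
  replace y with (2 * (y / 2)) at 1 4 by field.
  rewrite tmx_double, cos_2a_cos.
  apply Rmult_lt_compat_l with (r := 4 * cos (y / 2)) in H1; [|lra].
  eapply Rle_lt_trans; [|exact H1]. right; field.
Qed.

Lemma tmx_pos y : 0 < y < PI -> 0 < tmx y.
Proof.
  intros Hy; assert (H := tmx_lower y Hy); assert (H1 := one_plus_cos_pos y Hy).
  assert (0 < (1 + cos y) * (y^3 / 12 * (1 + y^2 / 10))); [|lra].
  apply Rmult_lt_0_compat; [assumption|].
  apply Rmult_lt_0_compat; [apply Rdiv_lt_0_compat; [apply pow_lt|]; lra | nra].
Qed.

Lemma rho_pos y : 0 < y < PI -> 0 < rho y.
Proof.
  intros Hy; assert (HP := PI_upper).
  assert (H1 := numer_pos y ltac:(lra)); assert (H2 := denom_pos y ltac:(lra)).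
  assert (H3 := tmx_pos y Hy); assert (H4 := one_plus_cos_pos y Hy).
  apply Rdiv_lt_0_compat; repeat apply Rmult_lt_0_compat; lra.
Qed.

(* [(1 + y^2/10) * (1 - y^2/21) >= 1] exactly when [y^2 <= 11], and [PI^2 < 11]. *)
Lemma rho_upper y : 0 < y < PI -> rho y < 1 / 35.
Proof.
  intros Hy; assert (HP := PI_upper).
  assert (H1 := numer_upper y ltac:(lra)); assert (H2 := denom_lower y ltac:(lra)).
  assert (H3 := tmx_lower y Hy); assert (H4 := one_plus_cos_pos y Hy).
  assert (H5 := denom_pos y ltac:(lra)); assert (H6 := tmx_pos y Hy).
  assert (Hz : 0 < y^2 < 9.93) by nra.
  assert (H8 : 0 < y^8) by (apply pow_lt; lra).
  assert (Hlow : (y^5 / 60 * (1 - y^2 / 21)) * ((1 + cos y) * (y^3 / 12 * (1 + y^2 / 10)))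
                 < denom y * tmx y).
  { apply Rmult_le_0_lt_compat; try assumption.
    - apply Rmult_le_pos; [|lra].
      assert (0 < y^5) by (apply pow_lt; lra); lra.
    - apply Rmult_le_pos; [lra|]; apply Rmult_le_pos; [|lra].
      assert (0 < y^3) by (apply pow_lt; lra); lra. }
  assert (Hnum : numer y * (1 + cos y) < y^8 / 5040 * (1 + cos y))
    by (apply Rmult_lt_compat_r; assumption).
  assert (Hprod : 0 <= (y^8 * (1 + cos y)) * ((1 - y^2 / 21) * (1 + y^2 / 10) - 1)).
  { apply Rmult_le_pos; [|nra].
    apply Rmult_le_pos; lra. }
  unfold rho.
  apply Rlt_div_l; [repeat apply Rmult_lt_0_compat; lra | lra].
Qed.

(** With [rho_upper] this makes 1/35 the limit of [rho] at 0, the quotient of the leading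
    coefficients 2/5040 and 5/(60 * 6). It serves to show that 34/35 is sharp. *)
Lemma rho_lower y : 0 < y <= 1 -> (1 - y^2 / 2) / 35 < rho y.
Proof.
  intros Hy; assert (HP := PI2_3_2).
  assert (H1 := numer_lower y ltac:(lra)); assert (H2 := denom_upper y ltac:(lra)).
  assert (H3 := tmx_upper y ltac:(lra)); assert (H4 := one_plus_cos_pos y ltac:(lra)).
  assert (H5 := denom_pos y ltac:(lra)); assert (H6 := tmx_pos y ltac:(lra)).
  assert (H7 := cos_ge_quadratic y ltac:(lra)).
  assert (Hz : 0 < y^2 <= 1) by nra.
  assert (H8 : 0 < y^8) by (apply pow_lt; lra).
  assert (Hup : denom y * tmx y < (y^5 / 60) * (y^3 / 6))
    by (apply Rmult_le_0_lt_compat; lra).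
  assert (Hnum : y^8 / 5040 * (1 - y^2 / 30) * (2 - y^2 / 2) <= numer y * (1 + cos y)).
  { apply Rmult_le_compat; try lra.
    apply Rmult_le_pos; lra. }
  assert (Hprod : 0 <= y^8 * ((1 - y^2 / 30) * (2 - y^2 / 2) - 2 * (1 - y^2 / 2))).
  { apply Rmult_le_pos; [lra | nra]. }
  assert (Hup' := Rmult_lt_compat_l (1 - y^2 / 2) _ _ ltac:(lra) Hup).
  unfold rho.
  apply (Rlt_div_r _ (numer y * (1 + cos y))); [repeat apply Rmult_lt_0_compat; lra | lra].
Qed.

Lemma is_derive_numer y : is_derive numer y (dnumer y).
Proof. unfold numer, dnumer; auto_derive; [trivial | ring]. Qed.

Lemma is_derive_denom y : is_derive denom y (ddenom y).
Proof. unfold denom, ddenom; auto_derive; [trivial | ring]. Qed.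

Lemma is_derive_tmx y : is_derive tmx y (cos y - 1 + y * sin y).
Proof. unfold tmx; auto_derive; [trivial | ring]. Qed.

Lemma derive_pos_lt (f df : R -> R) (a b : R) :
  a < b -> (forall x, a <= x <= b -> is_derive f x (df x)) ->
  (forall x, a < x < b -> 0 < df x) -> f a < f b.
Proof.
  intros Hab Hd Hp.
  destruct (MVT_cor2 f df a b Hab) as [c [E Hc]].
  - intros x Hx; apply is_derive_Reals, Hd, Hx.
  - assert (0 < df c * (b - a)) by (apply Rmult_lt_0_compat; [apply Hp|]; lra).
    lra.
Qed.

Lemma derive_neg_lt (f df : R -> R) (a b : R) :
  a < b -> (forall x, a <= x <= b -> is_derive f x (df x)) ->
  (forall x, a < x < b -> df x < 0) -> f b < f a.
Proof.
  intros Hab Hd Hp.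
  apply Ropp_lt_cancel.
  apply (derive_pos_lt (fun x => - f x) (fun x => - df x)); [assumption| |].
  - intros x Hx; apply @is_derive_opp, Hd, Hx.
  - intros x Hx; specialize (Hp x Hx); lra.
Qed.

(* The sign is that of the logarithmic derivative
   [numer'/numer - denom'/denom - (1 - cos)/tmx], where the bounds used are
   [8/y], [5/y - y/8] and [3/y + y/8]. *)
Lemma rho_decreasing y z : 0 < y -> y < z -> z < PI -> rho z < rho y.
Proof.
  intros H0 Hyz Hz; assert (HP := PI_upper).
  apply (derive_neg_lt rho (fun t =>
    (1 + cos t) * (dnumer t * denom t * tmx t - numer t * ddenom t * tmx t
                   - numer t * denom t * (1 - cos t)) / (5 * (denom t * tmx t)^2))); [assumption| |].
  - intros t Ht.
    assert (H2 := denom_pos t ltac:(lra)); assert (H3 := tmx_pos t ltac:(lra)).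
    unfold rho; auto_derive.
    + repeat split;
        [eexists; apply is_derive_numer | eexists; apply is_derive_denom
        | eexists; apply is_derive_tmx |].
      apply Rgt_not_eq; repeat apply Rmult_lt_0_compat; lra.
    + replace (Derive (fun x => numer x) t) with (dnumer t)
        by (symmetry; apply is_derive_unique, is_derive_numer).
      replace (Derive (fun x => denom x) t) with (ddenom t)
        by (symmetry; apply is_derive_unique, is_derive_denom).
      replace (Derive (fun x => tmx x) t) with (cos t - 1 + t * sin t)
        by (symmetry; apply is_derive_unique, is_derive_tmx).
      (* By this identity (1 + cos t)/tmx t has derivative -(1 + cos t)(1 - cos t)/(tmx t)^2. *)
      assert (E : sin t * tmx t + (1 + cos t) * (cos t - 1 + t * sin t)
                  = (1 + cos t) * (1 - cos t)).
      { unfold tmx.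
        assert (Es := sin2_cos2 t); unfold Rsqr in Es.
        lra. }
      transitivity (((1 + cos t) * (dnumer t * denom t * tmx t - numer t * ddenom t * tmx t)
        - numer t * denom t * (sin t * tmx t + (1 + cos t) * (cos t - 1 + t * sin t)))
        / (5 * (denom t * tmx t)^2)).
      * field; lra.
      * rewrite E; f_equal; ring.
  - intros t Ht.
    assert (H1 := numer_pos t ltac:(lra)).
    assert (H2 := denom_pos t ltac:(lra)); assert (H3 := tmx_pos t ltac:(lra)).
    assert (H4 := one_plus_cos_pos t ltac:(lra)).
    assert (B1 := numer_log_derive t ltac:(lra)).
    assert (B2 := denom_log_derive t ltac:(lra)).
    assert (B3 := tmx_log_derive t ltac:(lra)).
    set (w := dnumer t * denom t * tmx t - numer t * ddenom t * tmx t
              - numer t * denom t * (1 - cos t)).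
    assert (Hw : 0 < - w).
    { unfold w; apply Rmult_lt_reg_l with t; [lra|]; rewrite Rmult_0_r.
      (* Each bound on a logarithmic derivative is multiplied by the two other functions; the three
         products add up to -t w. *)
      assert (0 < denom t * tmx t * (8 * numer t - t * dnumer t))
        by (repeat apply Rmult_lt_0_compat; lra).
      assert (0 < numer t * tmx t * (t * ddenom t - (5 - t^2 / 8) * denom t))
        by (repeat apply Rmult_lt_0_compat; lra).
      assert (0 < numer t * denom t * (t * (1 - cos t) - (3 + t^2 / 8) * tmx t))
        by (repeat apply Rmult_lt_0_compat; lra).
      lra. }
    assert (0 < (1 + cos t) * - w / (5 * (denom t * tmx t)^2)); [|unfold Rdiv in *; lra].
    apply Rdiv_lt_0_compat; apply Rmult_lt_0_compat; try lra.
    apply pow_lt, Rmult_lt_0_compat; assumption.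
Qed.

(** * Passing signs to primitives *)

(** This form covers functions that are positive, negative, or first positive and then negative,
    without naming a zero. *)
Definition sign_once (b : R) (f : R -> R) : Prop :=
  forall x z, 0 < x -> x < z -> z < b -> f x <= 0 -> f z < 0.

(** The limit replaces a value at 0, where [slope] and [gap] divide by 0. As [f] increases, a
    negative f(x/2) would keep [f] below it near 0 and so away from the limit 0. *)
Lemma primitive_pos (f df : R -> R) (x : R) : 0 < x ->
  (forall t, 0 < t <= x -> is_derive f t (df t)) ->
  (forall t, 0 < t <= x -> 0 < df t) ->
  filterlim f (at_right 0) (locally 0) -> 0 < f x.
Proof.
  intros Hx Hd Hp Hl.
  assert (Hinc : forall s t, 0 < s -> s < t -> t <= x -> f s < f t).
  { intros s t Hs Hst Ht; apply (derive_pos_lt f df); [assumption| |];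
      intros u Hu; [apply Hd | apply Hp]; lra. }
  assert (H1 := Hinc (x / 2) x ltac:(lra) ltac:(lra) ltac:(lra)).
  destruct (Rle_or_lt 0 (f (x / 2))) as [H|H]; [lra|exfalso].
  assert (He : 0 < - f (x / 2)) by lra.
  destruct (Hl _ (locally_ball 0 (mkposreal _ He))) as [d Hdl].
  set (t := Rmin (d / 2) (x / 4)).
  assert (Hd0 := cond_pos d).
  assert (Ht : 0 < t) by (apply Rmin_pos; lra).
  assert (Ht1 := Rmin_l (d / 2) (x / 4)); assert (Ht2 := Rmin_r (d / 2) (x / 4)).
  fold t in Ht1, Ht2.
  assert (Hb : Rabs (f t - 0) < - f (x / 2)).
  { apply Hdl; [|exact Ht].
    change (Rabs (t - 0) < d); rewrite Rminus_0_r, Rabs_pos_eq; lra. }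
  apply Rabs_def2 in Hb.
  assert (H2 := Hinc t (x / 2) ltac:(lra) ltac:(lra) ltac:(lra)); lra.
Qed.

Lemma primitive_neg (f df : R -> R) (x : R) : 0 < x ->
  (forall t, 0 < t <= x -> is_derive f t (df t)) ->
  (forall t, 0 < t <= x -> df t < 0) ->
  filterlim f (at_right 0) (locally 0) -> f x < 0.
Proof.
  intros Hx Hd Hp Hl.
  assert (0 < - f x); [|lra].
  apply (primitive_pos (fun t => - f t) (fun t => - df t)); [assumption| | |].
  - intros t Ht; apply @is_derive_opp, Hd, Ht.
  - intros t Ht; specialize (Hp t Ht); lra.
  - replace (locally 0) with (locally (- 0)) by (now rewrite Ropp_0).
    apply (filterlim_comp _ _ _ f Ropp _ (locally 0)); [assumption|].
    apply (filterlim_opp 0).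
Qed.

(** By [primitive_pos], f(x) <= 0 forces [df] to be nonpositive at some u <= x, hence negative after
    u. *)
Lemma primitive_decreasing (b : R) (f df : R -> R) :
  (forall t, 0 < t < b -> is_derive f t (df t)) ->
  filterlim f (at_right 0) (locally 0) ->
  sign_once b df ->
  forall x s z, 0 < x -> x <= s -> s < z -> z < b -> f x <= 0 -> f z < f s.
Proof.
  intros Hd Hl Hs x s z Hx Hxs Hsz Hz Hf.
  assert (Hex : exists u, 0 < u <= x /\ df u <= 0).
  { apply NNPP; intros Hn.
    assert (0 < f x); [|lra].
    apply (primitive_pos f df); [assumption| | |assumption].
    - intros t Ht; apply Hd; lra.
    - intros t Ht; apply Rnot_le_lt; intros H; apply Hn; exists t; auto. }
  destruct Hex as [u [Hu Hdu]].
  apply (derive_neg_lt f df); [assumption| |].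
  - intros t Ht; apply Hd; lra.
  - intros t Ht; apply (Hs u t); lra.
Qed.

Lemma sign_once_primitive (b : R) (f df : R -> R) :
  (forall t, 0 < t < b -> is_derive f t (df t)) ->
  filterlim f (at_right 0) (locally 0) ->
  sign_once b df -> sign_once b f.
Proof.
  intros Hd Hl Hs x z Hx Hxz Hz Hf.
  assert (f z < f x); [|lra].
  apply (primitive_decreasing b f df Hd Hl Hs x x z); lra.
Qed.

(** * The mean M and the sign of the gap *)

(** Up to sign, the primitive of s^(p-1) vanishing at 1. The logarithmic branch absorbs the
    exceptional values q = 0 and q = 8/15 of [M] and [delta]. *)
Definition U (p s : R) : R :=
  if Req_EM_T p 0 then - ln s else (1 - Rpower s p) / p.

Lemma is_derive_U p s : 0 < s -> is_derive (U p) s (- Rpower s (p - 1)).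
Proof.
  intros Hs; unfold U; destruct (Req_EM_T p 0) as [->|Hp].
  - replace (0 - 1) with (- (1)) by ring; rewrite Rpower_Ropp, Rpower_1 by assumption.
    auto_derive; [assumption | ring].
  - assert (E : Rpower s p = Rpower s (p - 1) * s).
    { rewrite <- (Rpower_1 s) at 3 by assumption; rewrite <- Rpower_plus; f_equal; ring. }
    assert (Hd : is_derive (fun t => Rpower t p) s (p * Rpower s (p - 1))).
    { apply is_derive_Reals, derivable_pt_lim_power, Hs. }
    auto_derive.
    + exists (p * Rpower s (p - 1)); exact Hd.
    + replace (Derive (fun x => Rpower x p) s) with (p * Rpower s (p - 1))
        by (symmetry; apply is_derive_unique, Hd).
      field; assumption.
Qed.

Lemma Rpower_gt_0 x y : 0 < Rpower x y.
Proof. apply exp_pos. Qed.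

Lemma U_decreasing p s t : 0 < s -> s < t -> U p t < U p s.
Proof.
  intros Hs Hst; apply (derive_neg_lt _ (fun u => - Rpower u (p - 1))); [assumption| |].
  - intros u Hu; apply is_derive_U; lra.
  - intros u _; assert (H := Rpower_gt_0 u (p - 1)); lra.
Qed.

Lemma Rpower_1_l y : Rpower 1 y = 1.
Proof. unfold Rpower; rewrite ln_1, Rmult_0_r; apply exp_0. Qed.

Lemma U_1 p : U p 1 = 0.
Proof.
  unfold U; destruct (Req_EM_T p 0); [rewrite ln_1 | rewrite Rpower_1_l; unfold Rdiv]; ring.
Qed.

(** Since 5/(15q - 8) is the inverse of 3q - 8/5, raising [M t q] to the power 3q - 8/5 recovers its
    base 1 - (3q - 8/5) U_q(t)/3. At q = 0 or q = 8/15 one of the two [U] is a logarithm. *)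
Lemma M_spec t q : 0 < t < 1 ->
  0 < M t q /\ U (3 * q - 8 / 5) (M t q) = U q t / 3.
Proof.
  intros Ht.
  assert (HU : 0 < U q t) by (rewrite <- (U_1 q); apply U_decreasing; lra).
  unfold M; destruct (Req_EM_T q 0) as [->|Hq].
  - split; [apply Rpower_gt_0|].
    unfold U in *; destruct (Req_EM_T 0 0); [|lra].
    destruct (Req_EM_T (3 * 0 - 8 / 5) 0); [lra|].
    rewrite Rpower_mult.
    replace (- (5 / 8) * (3 * 0 - 8 / 5)) with 1 by field.
    rewrite Rpower_1 by lra; field.
  - destruct (Req_EM_T q (8 / 15)) as [->|Hq'].
    + split; [apply exp_pos|].
      unfold U; destruct (Req_EM_T (3 * (8 / 15) - 8 / 5) 0); [|lra].
      destruct (Req_EM_T (8 / 15) 0); [lra|].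
      rewrite ln_exp; field.
    + split; [apply Rpower_gt_0|].
      unfold U in *; destruct (Req_EM_T (3 * q - 8 / 5) 0); [lra|].
      destruct (Req_EM_T q 0); [contradiction|].
      (* Rewritten as t^q + (8/15) U_q(t), the base is positive whatever the sign of 1 - 8/(15q). *)
      assert (Hb : 0 < 8 / (15 * q) + (1 - 8 / (15 * q)) * Rpower t q).
      { assert (H := Rpower_gt_0 t q).
        replace (8 / (15 * q) + (1 - 8 / (15 * q)) * Rpower t q)
          with (Rpower t q + 8 / 15 * ((1 - Rpower t q) / q)) by (field; assumption).
        lra. }
      rewrite Rpower_mult.
      replace (5 / (15 * q - 8) * (3 * q - 8 / 5)) with 1 by (field; lra).
      rewrite Rpower_1 by assumption; field; lra.
Qed.

Lemma lt_M_iff s t q : 0 < s -> 0 < t < 1 ->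
  s < M t q <-> 0 < U (3 * q - 8 / 5) s - U q t / 3.
Proof.
  intros Hs Ht; destruct (M_spec t q Ht) as [HM <-]; split; intros H.
  - assert (H1 := U_decreasing (3 * q - 8 / 5) _ _ Hs H); lra.
  - destruct (Rlt_or_le s (M t q)) as [|[H1|H1]]; [assumption| |rewrite H1 in H; lra].
    apply (U_decreasing (3 * q - 8 / 5)) in H1; lra.
Qed.

Lemma gt_M_iff s t q : 0 < s -> 0 < t < 1 ->
  s > M t q <-> U (3 * q - 8 / 5) s - U q t / 3 < 0.
Proof.
  intros Hs Ht; destruct (M_spec t q Ht) as [HM <-]; split; intros H.
  - assert (H1 := U_decreasing (3 * q - 8 / 5) _ _ HM H); lra.
  - destruct (Rlt_or_le (M t q) s) as [|[H1|H1]]; [assumption| |rewrite H1 in H; lra].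
    apply (U_decreasing (3 * q - 8 / 5)) in H1; lra.
Qed.

(* [sin x / x > M (cos x) q] iff [gap q x < 0]. *)
Definition gap (q x : R) : R := U (3 * q - 8 / 5) (sin x / x) - U q (cos x) / 3.

(* Logarithm of the quotient of the two terms of the derivative of [gap q]. *)
Definition slope (q x : R) : R :=
  ln (3 * (sin x - x * cos x) / x^3) + (3 * q - 18 / 5) * ln (sin x / x)
  + (1 - q) * ln (cos x).

Definition dslope (q x : R) : R :=
  denom (2 * x) / (2 * x * sin x * cos x) * (rho (2 * x) - (1 - q)).

Lemma quadrant x : 0 < x < PI / 2 ->
  0 < sin x /\ 0 < cos x < 1 /\ 0 < sin x / x.
Proof.
  intros Hx; assert (Hs : 0 < sin x) by (apply sin_gt_0; lra).
  repeat split; [assumption | apply cos_gt_0; lra | | apply Rdiv_lt_0_compat; lra].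
  rewrite <- cos_0; apply cos_decreasing_1; lra.
Qed.

Lemma is_derive_sinc x : 0 < x ->
  is_derive (fun t => sin t / t) x (- (sin x - x * cos x) / x^2).
Proof. intros Hx; auto_derive; [lra | field; lra]. Qed.

Lemma is_derive_gap q x : 0 < x < PI / 2 ->
  is_derive (gap q) x
    (Rpower (cos x) (q - 1) * sin x / 3 * (exp (slope q x) - 1)).
Proof.
  intros Hx; destruct (quadrant x Hx) as [Hs [Hc Hr]].
  assert (Hd := tan_sub_pos x Hx).
  evar_last.
  { apply @is_derive_minus.
    - apply (is_derive_comp (U (3 * q - 8 / 5)) (fun t => sin t / t));
        [apply is_derive_U, Hr | apply is_derive_sinc; lra].
    - apply (is_derive_ext (fun t => / 3 * U q (cos t))).
      { intros t; change (/ 3 * U q (cos t) = U q (cos t) / 3); field. }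
      apply is_derive_scal, (is_derive_comp (U q) cos);
        [apply is_derive_U; lra | apply is_derive_cos]. }
  unfold slope; rewrite !exp_plus, exp_ln.
  2:{ apply Rdiv_lt_0_compat; [lra | apply pow_lt; lra]. }
  fold (Rpower (sin x / x) (3 * q - 18 / 5)); fold (Rpower (cos x) (1 - q)).
  (* One factor sin x / x is split off: it cancels the sin x of the other term and turns x^2 into
     the x^3 of [slope]. *)
  replace (3 * q - 8 / 5 - 1) with (1 + (3 * q - 18 / 5)) by field.
  rewrite Rpower_plus, Rpower_1 by assumption.
  replace (1 - q) with (- (q - 1)) by ring; rewrite Rpower_Ropp.
  assert (Hp := Rpower_gt_0 (cos x) (q - 1)).
  unfold scal, minus, plus, opp; simpl; unfold mult; simpl.
  field; lra.
Qed.

Lemma is_derive_slope q x : 0 < x < PI / 2 -> is_derive (slope q) x (dslope q x).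
Proof.
  intros Hx; destruct (quadrant x Hx) as [Hs [Hc Hr]].
  assert (Hd := tan_sub_pos x Hx); assert (HP := PI_upper).
  assert (Hden := denom_pos (2 * x) ltac:(lra)).
  unfold slope; auto_derive.
  { assert (0 < x * (x * (x * 1))) by (repeat apply Rmult_lt_0_compat; lra).
    repeat split; try lra.
    apply (Rdiv_lt_0_compat (3 * (sin x - x * cos x))); lra. }
  unfold dslope, rho; rewrite tmx_double.
  assert (Es := sin2_cos2 x); unfold Rsqr in Es.
  assert (E2 : cos x ^ 2 = 1 - sin x ^ 2) by (simpl; lra).
  transitivity (x * sin x / (sin x - x * cos x) - 3 / x
    + (3 * q - 18 / 5) * (cos x / sin x - 1 / x) - (1 - q) * (sin x / cos x)).
  { field; lra. }
  (* In this form, homogeneous of degree 2 in sin x and cos x, the remaining identity is purely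
     rational, without sin^2 + cos^2 = 1. *)
  assert (En : numer (2 * x) = 20 * x^2 * sin x^2 + 12 * x^2 * cos x^2 - 48 * sin x^2
                             + 36 * x * sin x * cos x).
  { unfold numer; rewrite cos_2a_cos, sin_2a.
    replace (20 * x^2 * sin x^2) with (20 * x^2 * (1 - cos x^2)) by (rewrite E2; ring).
    replace (48 * sin x^2) with (48 * (1 - cos x^2)) by (rewrite E2; ring).
    ring. }
  assert (Ed : denom (2 * x) = 2 * x * sin x^2 + 6 * x * cos x^2 - 6 * sin x * cos x).
  { unfold denom; rewrite cos_2a_cos, sin_2a.
    replace (2 * x * sin x^2) with (2 * x * (1 - cos x^2)) by (rewrite E2; ring).
    ring. }
  transitivity (numer (2 * x) * (2 * cos x * cos x)
      / (40 * x * sin x * cos x ^ 2 * (sin x - x * cos x))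
    - (1 - q) * denom (2 * x) / (2 * x * sin x * cos x)).
  - rewrite En, Ed; field; lra.
  - rewrite cos_2a_cos; field; lra.
Qed.

(** * Limits of slope and gap at the end points of (0, PI/2) *)

Lemma filterlim_within (f : R -> R) (D : R -> Prop) (a l : R) :
  ex_derive f a -> f a = l -> filterlim f (within D (locally a)) (locally l).
Proof.
  intros Hf <-; eapply filterlim_filter_le_1; [apply filter_le_within; typeclasses eauto|].
  apply (ex_derive_continuous f a), Hf.
Qed.

Lemma filterlim_comp_derive (f g : R -> R) (F : (R -> Prop) -> Prop) (a l : R) :
  filterlim f F (locally a) -> ex_derive g a -> g a = l ->
  filterlim (fun x => g (f x)) F (locally l).
Proof.
  intros Hf Hg <-; apply (filterlim_comp _ _ _ f g _ (locally a)); [assumption|].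
  apply (ex_derive_continuous g a), Hg.
Qed.

Lemma filterlim_plus_0 (f g : R -> R) (F : (R -> Prop) -> Prop) {FF : Filter F} (a : R) :
  filterlim f F (locally a) -> filterlim g F (locally 0) ->
  filterlim (fun x => f x + g x) F (locally a).
Proof.
  intros Hf Hg; apply (filterlim_comp_2 f g Rplus Hf Hg).
  assert (H := filterlim_plus (V := R_NormedModule) a 0).
  change (plus a 0) with (a + 0) in H; rewrite Rplus_0_r in H; exact H.
Qed.

Lemma squeeze_at_0_right (f : R -> R) :
  (forall x, 0 < x < 1 -> 1 - x <= f x <= 1 + x) -> filterlim f (at_right 0) (locally 1).
Proof.
  intros Hf.
  apply (filterlim_le_le (fun x => 1 - x) f (fun x => 1 + x) (Finite 1)).
  - exists (mkposreal 1 Rlt_0_1); intros x Hb H0; apply Hf.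
    change (Rabs (x - 0) < 1) in Hb; rewrite Rminus_0_r in Hb.
    apply Rabs_def2 in Hb; lra.
  - apply filterlim_within; [auto_derive; trivial | ring].
  - apply filterlim_within; [auto_derive; trivial | ring].
Qed.

Lemma cos_lim_0 : filterlim cos (at_right 0) (locally 1).
Proof.
  apply squeeze_at_0_right; intros x Hx.
  assert (H1 := cos_ge_quadratic x ltac:(lra)); assert (H2 := COS_bound x).
  split; nra.
Qed.

Lemma sinc_lim_0 : filterlim (fun x => sin x / x) (at_right 0) (locally 1).
Proof.
  apply squeeze_at_0_right; intros x Hx.
  assert (H1 := sin_ge_cubic x ltac:(lra)); assert (H2 := sin_lt_x x ltac:(lra)).
  split.
  - apply Rle_div_r; [lra | nra].
  - apply Rle_div_l; [lra | nra].
Qed.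

Lemma sin_sub_mul_cos_lim_0 :
  filterlim (fun x => 3 * (sin x - x * cos x) / x^3) (at_right 0) (locally 1).
Proof.
  apply squeeze_at_0_right; intros x Hx.
  assert (H1 := sin_sub_mul_cos_upper x ltac:(lra)).
  assert (H2 := sin_sub_mul_cos_lower x ltac:(lra)).
  assert (H3 := cos_ge_quadratic x ltac:(lra)).
  assert (H4 : 0 < x^3) by (apply pow_lt; lra).
  split.
  - apply Rle_div_r; [assumption|].
    assert (H5 : 0 <= x^3 * (cos x - (1 - x^2 / 2))) by (apply Rmult_le_pos; lra).
    assert (H6 : 0 <= x^3 * x^2 * cos x)
      by (repeat apply Rmult_le_pos; try apply pow2_ge_0; nra).
    assert (H7 : 0 <= x^3 * (x - x^2 / 2)) by (apply Rmult_le_pos; nra).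
    lra.
  - apply Rle_div_l; [assumption|].
    assert (H5 : 0 <= x^3 * (x - x^2 / 20)) by (apply Rmult_le_pos; nra).
    lra.
Qed.

Lemma slope_lim_0 q : filterlim (slope q) (at_right 0) (locally 0).
Proof.
  assert (Hln : forall k f, filterlim f (at_right 0) (locally 1) ->
            filterlim (fun x => k * ln (f x)) (at_right 0) (locally 0)).
  { intros k f Hf; apply (filterlim_comp_derive f (fun y => k * ln y) _ 1); [assumption| |].
    - auto_derive; lra.
    - rewrite ln_1; ring. }
  apply filterlim_plus_0; [typeclasses eauto| |apply Hln, cos_lim_0].
  apply filterlim_plus_0; [typeclasses eauto| |apply Hln, sinc_lim_0].
  eapply filterlim_ext; [|apply (Hln 1), sin_sub_mul_cos_lim_0].
  intros x; apply Rmult_1_l.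
Qed.

Lemma gap_lim_0 q : filterlim (gap q) (at_right 0) (locally 0).
Proof.
  apply (filterlim_plus_0 (fun x => U (3 * q - 8 / 5) (sin x / x)) (fun x => - (U q (cos x) / 3)));
    [typeclasses eauto| |].
  - apply (filterlim_comp_derive _ (U (3 * q - 8 / 5)) _ 1); [apply sinc_lim_0| |apply U_1].
    eexists; apply is_derive_U, Rlt_0_1.
  - apply (filterlim_comp_derive cos (fun y => - (U q y / 3)) _ 1); [apply cos_lim_0| |].
    + auto_derive; eexists; apply is_derive_U, Rlt_0_1.
    + rewrite U_1; field.
Qed.

Lemma delta_eq q : 0 < q -> delta q = U (3 * q - 8 / 5) (2 / PI) - 1 / (3 * q).
Proof.
  intros Hq; unfold delta, U; assert (HP := PI_RGT_0).
  destruct (Req_EM_T q (8 / 15)) as [->|H]; destruct (Req_EM_T _ 0); try lra.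
  replace (PI / 2) with (/ (2 / PI)) by (field; lra).
  rewrite ln_Rinv by (apply Rdiv_lt_0_compat; lra); field.
Qed.

(** [Rpower 0 q] is 1, so the function is not continuous at PI/2 and the left limit is computed
    directly. *)
Lemma Rpower_cos_lim q : 0 < q ->
  filterlim (fun x => Rpower (cos x) q) (at_left (PI / 2)) (locally 0).
Proof.
  intros Hq; apply filterlim_locally; intros eps.
  assert (HP := PI2_3_2).
  assert (Hcos : filterlim cos (at_left (PI / 2)) (locally 0)).
  { apply filterlim_within; [auto_derive; trivial | apply cos_PI2]. }
  set (e := Rpower eps (/ q)).
  assert (He : 0 < e) by apply Rpower_gt_0.
  assert (H1 : at_left (PI / 2) (fun x => Rabs (cos x - 0) < e))
    by (apply (Hcos _ (locally_ball 0 (mkposreal e He)))).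
  assert (H2 : at_left (PI / 2) (fun x => 0 < cos x)).
  { exists (mkposreal 1 Rlt_0_1); intros x Hb H0.
    change (Rabs (x - PI / 2) < 1) in Hb; apply Rabs_def2 in Hb.
    apply cos_gt_0; lra. }
  generalize (filter_and _ _ H1 H2); apply filter_imp; intros x [Ha Hb].
  change (Rabs (Rpower (cos x) q - 0) < eps).
  rewrite Rminus_0_r in *; rewrite Rabs_pos_eq in * by (try apply Rlt_le, Rpower_gt_0; lra).
  replace (pos eps) with (Rpower e q).
  - apply Rlt_Rpower_l; lra.
  - unfold e; rewrite Rpower_mult, Rinv_l, Rpower_1; [reflexivity | apply cond_pos | lra].
Qed.

(** For q > 0, U_q(cos x)/3 = (1 - (cos x)^q)/(3q) tends to 1/(3q), while the term in sin x / x is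
    continuous at PI/2. *)
Lemma gap_lim_PI2 q : 0 < q -> filterlim (gap q) (at_left (PI / 2)) (locally (delta q)).
Proof.
  intros Hq; rewrite delta_eq by assumption; assert (HP := PI_RGT_0).
  apply filterlim_ext with (fun x => (U (3 * q - 8 / 5) (sin x / x) - 1 / (3 * q))
                                     + / (3 * q) * Rpower (cos x) q).
  { intros x; unfold gap, U at 3; destruct (Req_EM_T q 0); [lra | field; lra]. }
  apply filterlim_plus_0; [typeclasses eauto| |].
  - apply (filterlim_within (fun x => U (3 * q - 8 / 5) (sin x / x) - 1 / (3 * q))).
    + eexists; apply @is_derive_minus; [|apply is_derive_const].
      apply (is_derive_comp (U (3 * q - 8 / 5)) (fun t => sin t / t));
        [apply is_derive_U; rewrite sin_PI2; apply Rdiv_lt_0_compat; lra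
        | apply is_derive_sinc; lra].
    + rewrite sin_PI2; do 2 f_equal; field; lra.
  - apply (filterlim_comp_derive _ (fun y => / (3 * q) * y) _ 0); [apply Rpower_cos_lim, Hq| |].
    + auto_derive; trivial.
    + ring.
Qed.

(** * Signs of the derivatives, of slope and of gap *)

Lemma dslope_factor q x : 0 < x < PI / 2 ->
  exists w, 0 < w /\ dslope q x = w * (rho (2 * x) - (1 - q)).
Proof.
  intros Hx; destruct (quadrant x Hx) as [Hs [Hc _]]; assert (HP := PI_upper).
  eexists; split; [|reflexivity].
  apply Rdiv_lt_0_compat; [apply denom_pos; lra|].
  repeat apply Rmult_lt_0_compat; lra.
Qed.

Lemma dgap_weight_pos q x : 0 < x < PI / 2 -> 0 < Rpower (cos x) (q - 1) * sin x / 3.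
Proof.
  intros Hx; destruct (quadrant x Hx) as [Hs _].
  assert (H := Rpower_gt_0 (cos x) (q - 1)).
  apply Rdiv_lt_0_compat; [apply Rmult_lt_0_compat|]; lra.
Qed.

Lemma dslope_sign_once q : sign_once (PI / 2) (dslope q).
Proof.
  intros x z Hx Hxz Hz H.
  destruct (dslope_factor q x) as [w [Hw E]]; [lra|].
  destruct (dslope_factor q z) as [v [Hv Ev]]; [lra|].
  rewrite E in H; rewrite Ev.
  assert (Hd := rho_decreasing (2 * x) (2 * z) ltac:(lra) ltac:(lra) ltac:(lra)).
  assert (rho (2 * x) - (1 - q) <= 0) by nra.
  nra.
Qed.

Lemma exp_sub_1_sign s : (0 < s -> 0 < exp s - 1) /\ (s < 0 -> exp s - 1 < 0).
Proof.
  rewrite <- exp_0; split; intros H; apply exp_increasing in H; lra.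
Qed.

Lemma slope_sign_once q : sign_once (PI / 2) (slope q).
Proof.
  apply (sign_once_primitive _ _ (dslope q));
    [apply is_derive_slope | apply slope_lim_0 | apply dslope_sign_once].
Qed.

Lemma dgap_sign_once q : sign_once (PI / 2)
  (fun x => Rpower (cos x) (q - 1) * sin x / 3 * (exp (slope q x) - 1)).
Proof.
  intros x z Hx Hxz Hz H.
  assert (Wx := dgap_weight_pos q x ltac:(lra)); assert (Wz := dgap_weight_pos q z ltac:(lra)).
  assert (Hs : slope q x <= 0).
  { apply Rnot_lt_le; intros Hn; apply (exp_sub_1_sign (slope q x)) in Hn; nra. }
  assert (Hz' := slope_sign_once q x z Hx Hxz Hz Hs).
  apply (exp_sub_1_sign (slope q z)) in Hz'; nra.
Qed.

Lemma gap_decreasing_after q x s z : 0 < x -> x <= s -> s < z -> z < PI / 2 ->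
  gap q x <= 0 -> gap q z < gap q s.
Proof.
  apply (primitive_decreasing (PI / 2) (gap q) _
           (is_derive_gap q) (gap_lim_0 q) (dgap_sign_once q)).
Qed.

Lemma slope_neg q x : q <= 34 / 35 -> 0 < x < PI / 2 -> slope q x < 0.
Proof.
  intros Hq Hx; apply (primitive_neg _ (dslope q)); [lra| | |apply slope_lim_0].
  - intros t Ht; apply is_derive_slope; lra.
  - intros t Ht; destruct (dslope_factor q t) as [w [Hw ->]]; [lra|].
    assert (H := rho_upper (2 * t) ltac:(lra)); nra.
Qed.

Lemma gap_neg q x : q <= 34 / 35 -> 0 < x < PI / 2 -> gap q x < 0.
Proof.
  intros Hq Hx; eapply primitive_neg; [lra| | |apply gap_lim_0].
  - intros t Ht; apply is_derive_gap; lra.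
  - intros t Ht; simpl.
    assert (H := slope_neg q t Hq ltac:(lra)); apply (exp_sub_1_sign (slope q t)) in H.
    assert (W := dgap_weight_pos q t ltac:(lra)); nra.
Qed.

(** Asking for the inequality only up to [x] serves both q >= 1 with any x, and q > 34/35 with x
    small. *)
Lemma slope_pos q x : (forall t, 0 < t <= x -> 1 - q < rho (2 * t)) ->
  0 < x < PI / 2 -> 0 < slope q x.
Proof.
  intros Hq Hx; apply (primitive_pos _ (dslope q)); [lra| | |apply slope_lim_0].
  - intros t Ht; apply is_derive_slope; lra.
  - intros t Ht; destruct (dslope_factor q t) as [w [Hw ->]]; [lra|].
    specialize (Hq t Ht); nra.
Qed.

Lemma dgap_pos q x : (forall t, 0 < t <= x -> 1 - q < rho (2 * t)) ->
  0 < x < PI / 2 -> 0 < Rpower (cos x) (q - 1) * sin x / 3 * (exp (slope q x) - 1).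
Proof.
  intros Hq Hx.
  assert (H := slope_pos q x Hq Hx); apply (exp_sub_1_sign (slope q x)) in H.
  assert (W := dgap_weight_pos q x Hx); nra.
Qed.

Lemma gap_pos q x : (forall t, 0 < t <= x -> 1 - q < rho (2 * t)) ->
  0 < x < PI / 2 -> 0 < gap q x.
Proof.
  intros Hq Hx; eapply primitive_pos; [lra| | |apply gap_lim_0].
  - intros t Ht; apply is_derive_gap; lra.
  - intros t Ht; simpl; apply dgap_pos; [|lra].
    intros u Hu; apply Hq; lra.
Qed.

Lemma gap_pos_of_ge_1 q x : 1 <= q -> 0 < x < PI / 2 -> 0 < gap q x.
Proof.
  intros Hq Hx; apply gap_pos; [|assumption].
  intros t Ht; assert (H := rho_pos (2 * t) ltac:(lra)); lra.
Qed.

Lemma gap_pos_near_0 q : 34 / 35 < q -> exists x, 0 < x < PI / 2 /\ 0 < gap q x.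
Proof.
  intros Hq; assert (HP := PI2_3_2).
  (* For 2t <= y <= 1 one has (2t)^2 <= y <= 35q - 34, and then the bound of [rho_lower] at 2t
     exceeds 1 - q. *)
  set (y := Rmin 1 (35 * q - 34)).
  assert (Hy0 : 0 < y) by (apply Rmin_pos; lra).
  assert (Hy1 := Rmin_l 1 (35 * q - 34)); assert (Hy2 := Rmin_r 1 (35 * q - 34)).
  fold y in Hy1, Hy2.
  exists (y / 2); split; [lra|].
  apply gap_pos; [|lra].
  intros t Ht; assert (H := rho_lower (2 * t) ltac:(lra)).
  assert ((2 * t)^2 <= y) by nra.
  lra.
Qed.

(** * Sign, monotonicity and root of delta *)

Lemma locally_lt (f : R -> R) (F : (R -> Prop) -> Prop) (l m : R) :
  filterlim f F (locally l) -> l < m -> F (fun x => f x < m).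
Proof.
  intros Hf Hlm; apply (Hf (fun y => y < m)); apply open_lt; exact Hlm.
Qed.

Lemma locally_gt (f : R -> R) (F : (R -> Prop) -> Prop) (l m : R) :
  filterlim f F (locally l) -> m < l -> F (fun x => m < f x).
Proof.
  intros Hf Hlm; apply (Hf (fun y => m < y)); apply open_gt; exact Hlm.
Qed.

Lemma at_left_exists (P : R -> Prop) (a b : R) : a < b ->
  at_left b P -> exists x, a < x < b /\ P x.
Proof.
  intros Hab [d Hd]; assert (H0 := cond_pos d).
  set (h := Rmin (d / 2) ((b - a) / 2)).
  assert (Hh : 0 < h) by (apply Rmin_pos; lra).
  assert (H1 := Rmin_l (d / 2) ((b - a) / 2)); assert (H2 := Rmin_r (d / 2) ((b - a) / 2)).
  fold h in H1, H2.
  exists (b - h); split; [lra|]; apply Hd; [|lra].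
  change (Rabs (b - h - b) < d); rewrite Rabs_left; lra.
Qed.

Lemma gap_neg_of_delta_neg q : 0 < q -> delta q < 0 ->
  exists x, 0 < x < PI / 2 /\ gap q x < 0.
Proof.
  intros Hq Hd; assert (HP := PI2_3_2).
  apply at_left_exists; [lra|].
  apply (locally_lt _ _ _ _ (gap_lim_PI2 q Hq) Hd).
Qed.

(** From [x] on [gap q] decreases, so its limit [delta q] is at most its value at the midpoint m,
    which is strictly below gap q x <= 0. *)
Lemma delta_neg_of_gap_nonpos q x : 0 < q -> 0 < x < PI / 2 -> gap q x <= 0 -> delta q < 0.
Proof.
  intros Hq Hx Hg; set (m := (x + PI / 2) / 2).
  assert (Hm : x < m < PI / 2) by (unfold m; lra).
  assert (Hgm := gap_decreasing_after q x x m ltac:(lra) ltac:(lra) ltac:(lra) ltac:(lra) Hg).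
  apply Rnot_le_lt; intros Hd.
  destruct (at_left_exists _ m (PI / 2) ltac:(lra)
              (locally_gt _ _ _ (gap q m) (gap_lim_PI2 q Hq) ltac:(lra))) as [z [Hz Hgz]].
  assert (H := gap_decreasing_after q x m z ltac:(lra) ltac:(lra) ltac:(lra) ltac:(lra) Hg).
  lra.
Qed.

Lemma delta_neg q : 0 < q <= 34 / 35 -> delta q < 0.
Proof.
  intros Hq; assert (HP := PI2_3_2).
  apply delta_neg_of_gap_nonpos with 1; [lra | lra |].
  apply Rlt_le, gap_neg; lra.
Qed.

Lemma delta_pos_of_ge_1 q : 1 <= q -> 0 < delta q.
Proof.
  intros Hq; assert (HP := PI2_3_2).
  assert (H1 := gap_pos_of_ge_1 q 1 Hq ltac:(lra)).
  apply Rnot_le_lt; intros Hd.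
  destruct (at_left_exists _ 1 (PI / 2) ltac:(lra)
              (locally_lt _ _ _ (gap q 1) (gap_lim_PI2 q ltac:(lra)) ltac:(lra))) as [z [Hz Hgz]].
  assert (gap q 1 < gap q z); [|lra].
  eapply derive_pos_lt; [lra| |].
  - intros t Ht; apply is_derive_gap; lra.
  - intros t Ht; simpl; apply dgap_pos; [|lra].
    intros u Hu; assert (H := rho_pos (2 * u) ltac:(lra)); lra.
Qed.

(** [delta_increasing] needs (ln (PI/2))^2 < 2/9, and 0.47^2 < 2/9; the cubic Taylor polynomial of
    exp at 0.47 exceeds 1.575. *)
Lemma ln_PI2_upper : 0 < ln (PI / 2) < 0.47.
Proof.
  assert (HP := PI_upper); assert (HP' := PI2_3_2).
  split; [rewrite <- ln_1; apply ln_increasing; lra|].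
  apply exp_lt_inv; rewrite exp_ln by lra.
  assert (H := exp_ge_taylor 0.47 3 ltac:(lra)).
  simpl in H; lra.
Qed.

(** The two sides agree at 0 and their difference has derivative t (1 - exp (-t)). *)
Lemma exp_neg_lower y : 0 <= y -> 1 - y^2 / 2 <= (1 + y) * exp (- y).
Proof.
  intros Hy.
  assert (H : (1 + 0) * exp (- 0) - (1 - 0^2 / 2) <= (1 + y) * exp (- y) - (1 - y^2 / 2)).
  { apply (derive_nonneg_le (fun t => (1 + t) * exp (- t) - (1 - t^2 / 2))
             (fun t => t * (1 - exp (- t)))); [assumption| |].
    - intros t _; auto_derive; [trivial | field].
    - intros t Ht; apply Rmult_le_pos; [lra|].
      assert (exp (- t) <= exp 0) by (apply Rnot_lt_le; intros Hn; apply exp_lt_inv in Hn; lra).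
      rewrite exp_0 in *; lra. }
  rewrite Ropp_0, exp_0 in H; lra.
Qed.

Lemma is_derive_delta q : 34 / 35 <= q ->
  is_derive delta q
    (3 * ((1 + ln (PI / 2) * (3 * q - 8 / 5)) * exp (- (ln (PI / 2) * (3 * q - 8 / 5))) - 1)
       / (3 * q - 8 / 5)^2 + 1 / (3 * q^2)).
Proof.
  intros Hq; assert (HP := PI_RGT_0).
  apply (is_derive_ext_loc
           (fun t => (1 - exp (- (ln (PI / 2) * (3 * t - 8 / 5)))) / (3 * t - 8 / 5) - 1 / (3 * t))).
  - apply (filter_imp (fun t => 8 / 15 < t)); [|apply open_gt; lra].
    intros t Ht; unfold delta; destruct (Req_EM_T t (8 / 15)); [lra|].
    unfold Rpower; replace (2 / PI) with (/ (PI / 2)) by (field; lra).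
    rewrite ln_Rinv by lra.
    do 4 f_equal; ring.
  - auto_derive; [repeat split; lra | unfold Rminus, Rdiv; field; lra].
Qed.

(** In the derivative of [delta], the first term is at least -(3/2)(ln (PI/2))^2 > -1/3 by
    [exp_neg_lower], and the second at least 1/3 because the argument is at most 1. *)
Lemma delta_increasing q r : 34 / 35 <= q -> q < r -> r <= 1 -> delta q < delta r.
Proof.
  intros Hq Hqr Hr; eapply derive_pos_lt; [assumption| |].
  - intros t Ht; apply is_derive_delta; lra.
  - intros t Ht; simpl.
    set (L := ln (PI / 2)); set (p := 3 * t - 8 / 5).
    assert (HL : 0 < L < 0.47) by apply ln_PI2_upper.
    assert (Hp : 0 < p) by (unfold p; lra).
    assert (HpL : 0 < L * p) by (apply Rmult_lt_0_compat; lra).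
    assert (He := exp_neg_lower (L * p) ltac:(lra)).
    assert (Hp2 : 0 < p^2) by (apply pow_lt; lra).
    assert (H1 : - (3 / 2 * L^2) <= 3 * ((1 + L * p) * exp (- (L * p)) - 1) / p^2).
    { apply Rle_div_r; [assumption|].
      replace (- (3 / 2 * L^2) * p^2) with (3 * (- ((L * p)^2 / 2))) by field.
      lra. }
    assert (H2 : 1 / 3 <= 1 / (3 * t^2)).
    { apply (Rle_div_r (1 / 3) 1); nra. }
    simpl in *; nra.
Qed.

Lemma delta_root : exists q0, 34 / 35 < q0 < 1 /\ delta q0 = 0.
Proof.
  destruct (IVT_interv delta (34 / 35) 1) as [q0 [Hq0 E]].
  - intros a Ha; apply continuity_pt_filterlim, (ex_derive_continuous delta a).
    eexists; apply is_derive_delta; lra.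
  - lra.
  - apply delta_neg; lra.
  - apply delta_pos_of_ge_1; lra.
  - exists q0; split; [|exact E].
    assert (H1 := delta_neg (34 / 35) ltac:(lra)); assert (H2 := delta_pos_of_ge_1 1 ltac:(lra)).
    destruct Hq0 as [[Ha|Ha] [Hb|Hb]]; subst; lra.
Qed.

Theorem theorem8 :
  (forall q : R,
     (forall x : R, 0 < x < PI / 2 -> sin x / x > M (cos x) q) <-> q <= 34 / 35)
  /\
  (exists q0 : R,
     0 < q0 /\ delta q0 = 0 /\ (forall q : R, 0 < q -> delta q = 0 -> q = q0) /\
     (forall q : R,
        (forall x : R, 0 < x < PI / 2 -> sin x / x < M (cos x) q) <-> q0 <= q)).
Proof.
  assert (HP := PI2_3_2).
  split.
  - intros q; split.
    + intros H; apply Rnot_lt_le; intros Hq.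
      destruct (gap_pos_near_0 q Hq) as [x [Hx Hg]].
      destruct (quadrant x Hx) as [_ [Hc Hr]].
      apply (gt_M_iff _ _ _ Hr Hc) in H; [|assumption].
      unfold gap in Hg; lra.
    + intros Hq x Hx; destruct (quadrant x Hx) as [_ [Hc Hr]].
      apply gt_M_iff; [assumption..|]; apply gap_neg; assumption.
  - destruct delta_root as [q0 [Hq0 E]].
    exists q0; repeat split; [lra | assumption | | |].
    + intros q Hq Eq.
      (* Outside (34/35, 1) [delta] has a strict sign; inside it is injective. *)
      destruct (Rle_or_lt q (34 / 35)) as [H|H];
        [assert (D := delta_neg q ltac:(lra)); lra|].
      destruct (Rle_or_lt 1 q) as [H'|H'];
        [assert (D := delta_pos_of_ge_1 q H'); lra|].
      destruct (Rtotal_order q q0) as [Hlt|[He|Hgt]]; [|assumption|].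
      * assert (D := delta_increasing q q0 ltac:(lra) Hlt ltac:(lra)); lra.
      * assert (D := delta_increasing q0 q ltac:(lra) Hgt ltac:(lra)); lra.
    + intros H; apply Rnot_lt_le; intros Hq.
      assert (Hex : exists x, 0 < x < PI / 2 /\ gap q x < 0).
      (* For q <= 34/35, possibly not positive, [gap] is negative everywhere and x = 1 serves;
         otherwise delta q < delta q0 = 0 gives a point near PI/2. *)
      { destruct (Rle_or_lt q (34 / 35)) as [H'|H'].
        - exists 1; split; [lra | apply gap_neg; lra].
        - apply gap_neg_of_delta_neg; [lra|].
          rewrite <- E; apply delta_increasing; lra. }
      destruct Hex as [x [Hx Hg]]; destruct (quadrant x Hx) as [_ [Hc Hr]].
      specialize (H x Hx); apply (lt_M_iff _ _ _ Hr Hc) in H.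
      unfold gap in Hg; lra.
    + intros Hq x Hx; destruct (quadrant x Hx) as [_ [Hc Hr]].
      apply lt_M_iff; [assumption..|]; fold (gap q x).
      destruct (Rle_or_lt 1 q) as [H'|H']; [apply gap_pos_of_ge_1; assumption|].
      (* For q0 <= q < 1, a nonpositive value of [gap] would make [delta q] negative, although delta
         q >= delta q0 = 0. *)
      apply Rnot_le_lt; intros Hg.
      assert (D := delta_neg_of_gap_nonpos q x ltac:(lra) Hx Hg).
      destruct Hq as [Hq|Hq]; [|rewrite <- Hq in D; lra].
      assert (D' := delta_increasing q0 q ltac:(lra) Hq ltac:(lra)); lra.
Qed.
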